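(* Let $\psi:W\to W$ be defined recursively by $\psi(\varepsilon)=\varepsilon$ for the empty word $\varepsilon$ and, for nonempty $w\in W$, $$\psi(w)=\psi(w\setminus\mathsf{sw}(w))*\delta(\mathsf{sw}(w)),$$ where $*$ is concatenation and, if $c_1<\cdots<c_m$ are the entries of $\mathsf{sw}(w)$ and $d=\mathsf{des}(\mathsf{sw}(w))$, then $\delta(\mathsf{sw}(w))=c_{d+1}c_1c_2\cdots c_dc_{d+2}\cdots c_m$. Then $\psi$ is a well-defined bijection of $W$ such that $\mathsf{des}(w)=\mathsf{lec}(\psi(w))$ for all $w\in W$. Moreover, the restriction of $\psi$ to the symmetric group $\mathcal S_n$ (permutations in one-line notation) is a bijection $\mathcal S_n\to\mathcal S_n$.
   Context: $W$ is the set of all finite words ($\ell\ge0$) of positive integers with pairwise distinct entries. For $u=u_1\cdots u_\ell$, $\mathsf{des}(u)=\#\{j\in[\ell-1]:u_j>u_{j+1}\}$ and $\mathsf{inv}(u)=\#\{(p,q):p<q,\ u_p>u_q\}$. Special wave: let $w=w_1\cdots w_\ell\in W$ be nonempty. If the entries of $w$ are increasing, $\mathsf{sw}(w)=w$ and $w\setminus\mathsf{sw}(w)$ is empty. Otherwise let $t$ be minimal with $w_t>w_{t+1}$; let $r$ be minimal with $1\le r\le t$ and $w_r>w_{t+1}$; set $w_0=0$ and let $s$ be maximal with $t<s\le\ell$ and $w_{t+1}>\cdots>w_s>w_{r-1}$. Then $\mathsf{sw}(w)=w_r\cdots w_s$ and $w\setminus\mathsf{sw}(w)=w_1\cdots w_{r-1}w_{s+1}\cdots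 w_\ell$. Hook factorization: every $w\in W$ decomposes uniquely as $w=\gamma*\alpha_1*\cdots*\alpha_m$ with $\gamma$ a possibly empty increasing word and each $\alpha_j=a_1\cdots a_r$ a hook ($r\ge2$, $a_1>a_2$, $a_2<\cdots<a_r$); $\mathsf{lec}(w)=\sum_j\mathsf{inv}(\alpha_j)$. *)

(* Defs.v *)
From HB Require Import structures.
From mathcomp Require Import all_boot all_fingroup.

Set Implicit Arguments.
Unset Strict Implicit.
Unset Printing Implicit Defensive.

Definition inW (w : seq nat) : bool := uniq w && all (leq 1) w.

Record W := Word { letters :> seq nat; _ : inW letters }.
HB.instance Definition _ := [isSub for letters].
HB.instance Definition _ := [Countable of W by <:].

Definition emptyW : W := @Word [::] isT.

Definition des (u : seq nat) : nat :=
  #|[set j : 'I_(size u).-1 | nth 0 u j > nth 0 u j.+1]|.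

Definition inv (u : seq nat) : nat :=
  #|[set pq : 'I_(size u) * 'I_(size u) |
      (pq.1 < pq.2) && (nth 0 u pq.1 > nth 0 u pq.2)]|.

(* 1-based letters, with the convention [letter w 0 = 0]. *)
Definition letter (w : seq nat) (i : nat) : nat := nth 0 (0 :: w) i.

(* The lists filtered below are increasing, so [head] and [last] select the
   minimal and the maximal index satisfying the condition. *)
Definition sw_t (w : seq nat) : nat :=
  head 0 [seq t <- iota 1 (size w).-1 | letter w t > letter w t.+1].

Definition sw_r (w : seq nat) : nat :=
  let t := sw_t w in
  head 0 [seq r <- iota 1 t | letter w r > letter w t.+1].

Definition sw_s (w : seq nat) : nat :=
  let t := sw_t w in
  let r := sw_r w in
  last 0 [seq s <- iota t.+1 (size w - t) |
           all (fun i => letter w i > letter w i.+1) (iota t.+1 (s - t.+1))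
           && (letter w s > letter w r.-1)].

Definition sw (w : seq nat) : seq nat :=
  if sorted ltn w then w else drop (sw_r w).-1 (take (sw_s w) w).

Definition sw_rest (w : seq nat) : seq nat :=
  if sorted ltn w then [::] else take (sw_r w).-1 w ++ drop (sw_s w) w.

Lemma head_filter_iotaP (P : pred nat) (m n j : nat) :
  j \in iota m n -> P j ->
  let h := head 0 [seq i <- iota m n | P i] in
  [/\ h \in iota m n, P h & forall i, i \in iota m n -> P i -> h <= i].
Proof.
move=> jin Pj h.
have srt := sorted_filter leq_trans P (iota_sorted m n).
have jl : j \in [seq i <- iota m n | P i] by rewrite mem_filter Pj.
have : h \in [seq i <- iota m n | P i].
  by rewrite /h; case: [seq _ <- _ | _] jl => //= a s _; rewrite mem_head.
rewrite mem_filter => /andP[Ph hin]; split=> // i iin Pi.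
have : i \in [seq i <- iota m n | P i] by rewrite mem_filter Pi.
rewrite /h; case: [seq _ <- _ | _] srt => //= x s srt.
rewrite inE => /predU1P[->//|].
by have /allP := order_path_min leq_trans srt; apply.
Qed.

Lemma last_filter_iotaP (P : pred nat) (m n j : nat) :
  j \in iota m n -> P j ->
  let l := last 0 [seq i <- iota m n | P i] in
  [/\ l \in iota m n, P l & forall i, i \in iota m n -> P i -> i <= l].
Proof.
move=> jin Pj l.
have srt := sorted_filter leq_trans P (iota_sorted m n).
have jl : j \in [seq i <- iota m n | P i] by rewrite mem_filter Pj.
have : l \in [seq i <- iota m n | P i].
  by rewrite /l; case: [seq _ <- _ | _] jl => //= a s _; rewrite mem_last.
rewrite mem_filter => /andP[Pl lin]; split=> // i iin Pi.
have : i \in [seq i <- iota m n | P i] by rewrite mem_filter Pi.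
rewrite /l; case/lastP: [seq _ <- _ | _] srt => // s x.
rewrite last_rcons mem_rcons inE => srt /predU1P[->//|].
move: srt; rewrite -(rev_sorted) rev_rcons /= => srt si.
have geq_trans : transitive (fun y x : nat => x <= y).
  by move=> a b c /= ab ca; apply: leq_trans ca ab.
have /allP := order_path_min geq_trans srt; apply.
by rewrite mem_rev.
Qed.

Lemma letter_inj (w : seq nat) (i j : nat) : inW w ->
  i <= size w -> j <= size w -> letter w i = letter w j -> i = j.
Proof.
move=> /andP[w_uniq w_pos] iw jw /eqP.
rewrite /letter nth_uniq //=; first by move/eqP.
rewrite w_uniq andbT; apply/negP => /(allP w_pos).
by rewrite ltnn.
Qed.

Lemma sw_indices (w : seq nat) : inW w -> ~~ sorted ltn w ->
  [/\ 0 < sw_r w, sw_r w <= sw_t w, sw_t w < sw_s w & sw_s w <= size w].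
Proof.
move=> wW w_ninc.
have [t0 t0in Pt0] : exists2 t, t \in iota 1 (size w).-1
    & letter w t > letter w t.+1.
  apply/hasP; apply: contraNT w_ninc => /hasPn noP.
  apply/(sortedP 0) => i iw.
  have : i.+1 \in iota 1 (size w).-1.
    by rewrite mem_iota /= add1n ltnS; case: (size w) iw.
  move/noP; rewrite /letter /= -leqNgt leq_eqVlt => /predU1P[eqi|//].
  have /eqP := letter_inj wW (ltnW iw) iw eqi.
  by rewrite eqn_leq ltnn andbF.
have [] := head_filter_iotaP (P := fun t => letter w t > letter w t.+1) t0in Pt0.
rewrite -/(sw_t w) mem_iota add1n ltnS => /andP[t_gt0 t_le] Pt _.
have t_lt : sw_t w < size w.
  by move: t_le t_gt0; case: (size w) => [|k] /=; [rewrite leqn0 => /eqP-> | ].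
have tin : sw_t w \in iota 1 (sw_t w) by rewrite mem_iota t_gt0 add1n ltnS /=.
have [] := head_filter_iotaP
  (P := fun r => letter w r > letter w (sw_t w).+1) tin Pt.
rewrite -/(sw_r w) mem_iota add1n ltnS => /andP[r_gt0 r_le] Pr r_min.
have Ps : letter w (sw_r w).-1 < letter w (sw_t w).+1.
  rewrite ltnNge; apply/negP; rewrite leq_eqVlt => /predU1P[eqi | lti].
    have r1_le : (sw_r w).-1 <= sw_t w by apply: leq_trans (leq_pred _) r_le.
    have /eqP := letter_inj wW t_lt (leq_trans r1_le (ltnW t_lt)) eqi.
    by rewrite eqn_leq leqNgt ltnS r1_le.
  case: (posnP (sw_r w).-1) lti => [-> //|r1_gt0 lti].
  have := r_min (sw_r w).-1; rewrite mem_iota r1_gt0 add1n ltnS /=.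
  move/(_ (leq_trans (leq_pred _) r_le) lti).
  by rewrite leqNgt ltn_predL r_gt0.
have sin : (sw_t w).+1 \in iota (sw_t w).+1 (size w - sw_t w).
  by rewrite mem_iota leqnn -[X in X < _]addn0 ltn_add2l subn_gt0.
have [|] := last_filter_iotaP (P := fun s =>
    all (fun i => letter w i > letter w i.+1)
        (iota (sw_t w).+1 (s - (sw_t w).+1))
    && (letter w s > letter w (sw_r w).-1)) sin.
  by rewrite subnn.
rewrite -/(sw_s w) mem_iota addSn subnKC ?(ltnW t_lt) // ltnS.
by case/andP=> ts sl _ _; split.
Qed.

Lemma sw_rest_inW (w : W) : inW (sw_rest w).
Proof.
case: w => w /= wW; rewrite /sw_rest; case: ifPn => // w_ninc.
have [_ r_le /ltnW t_le _] := sw_indices wW w_ninc.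
have rs : (sw_r w).-1 <= sw_s w.
  by rewrite (leq_trans (leq_pred _)) // (leq_trans r_le).
have sub : subseq (take (sw_r w).-1 w ++ drop (sw_s w) w) w.
  rewrite -[X in subseq _ X](cat_take_drop (sw_r w).-1) cat_subseq //.
  by rewrite -(subnK rs) -drop_drop drop_subseq.
case/andP: wW => w_uniq w_pos; rewrite /inW (subseq_uniq sub) //=.
by apply/allP => x /(mem_subseq sub) /(allP w_pos).
Qed.

Definition restW (w : W) : W := Word (sw_rest_inW w).

(* With [c_1 < ... < c_m] the entries of [u] and [d = des u], this is
   [c_(d+1) c_1 ... c_d c_(d+2) ... c_m]; here [nth 0 c d] is [c_(d+1)]. *)
Definition delta (u : seq nat) : seq nat :=
  let c := sort leq u in
  let d := des u in
  nth 0 c d :: take d c ++ drop d.+1 c.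

Definition is_hook (a : seq nat) : bool :=
  if a is a1 :: (a2 :: _) as a' then (a1 > a2) && sorted ltn a' else false.

Definition is_hook_factorization (w : seq nat)
    (f : seq nat * seq (seq nat)) : bool :=
  [&& w == f.1 ++ flatten f.2, sorted ltn f.1 & all is_hook f.2].

Lemma hook_factorization_exists (w : W) :
  exists f, is_hook_factorization w f.
Proof.
case: w => w /= /andP[+ _].
elim: w => [|x w IHw] /=; first by exists ([::], [::]).
case/andP=> xNw /IHw[[g al]] /and3P[/= /eqP defw g_inc al_hook].
case: g => [|y g] in defw g_inc *.
  by exists ([:: x], al); rewrite /is_hook_factorization /= defw eqxx.
have [ltxy | leyx] := ltnP x y.
  exists (x :: y :: g, al); rewrite /is_hook_factorization /= defw eqxx.
  by rewrite ltxy /=; apply/andP.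
exists ([::], (x :: y :: g) :: al).
rewrite /is_hook_factorization /= defw eqxx al_hook andbT /=.
have ltyx : y < x.
  rewrite ltn_neqAle leyx andbT; apply: contraNneq xNw => <-.
  by rewrite defw inE eqxx.
by rewrite ltyx.
Qed.

Lemma hook_factorization_unique (w : seq nat) f1 f2 :
  is_hook_factorization w f1 -> is_hook_factorization w f2 -> f1 = f2.
Proof.
have behead_fact x v g al : is_hook_factorization (x :: v) (g, al) ->
    exists g' al', is_hook_factorization v (g', al') /\
      (g, al) = if (if g' is y :: _ then y < x else false)
                then ([::], (x :: g') :: al') else (x :: g', al').
  case: g => [|z g] /and3P[/= /eqP].
    case: al => [|[|z [|y a]] al] //= [<- ->] _ /andP[/andP[ltyx a_inc] al_h].
    exists (y :: a), al; split; last by rewrite ltyx.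
    by rewrite /is_hook_factorization /= eqxx a_inc.
  case=> <- -> g_inc al_h; exists g, al; split.
    by rewrite /is_hook_factorization /= eqxx (path_sorted g_inc).
  case: g g_inc => //= y g /andP[ltxy _].
  by rewrite ltnNge (ltnW ltxy).
elim: w f1 f2 => [|x w IHw] [g1 al1] [g2 al2].
  have nil g al : is_hook_factorization [::] (g, al) -> (g, al) = ([::], [::]).
    by case/and3P; case: g => //; case: al => [|[|]].
  by move=> /nil-> /nil->.
case/behead_fact=> h1 [bl1 [fact1 ->]] /behead_fact[h2 [bl2 [fact2 ->]]].
by case: (IHw _ _ fact1 fact2) => -> ->.
Qed.

Definition hook_factorization (w : W) : seq nat * seq (seq nat) :=
  xchoose (hook_factorization_exists w).

Definition lec (w : W) : nat :=
  \sum_(a <- (hook_factorization w).2) inv a.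

Definition psi_recursion (psi : W -> W) : Prop :=
  psi emptyW = emptyW /\
  forall w : W, w <> emptyW ->
    letters (psi w) = letters (psi (restW w)) ++ delta (sw w).

Lemma one_line_inW (n : nat) (s : 'S_n) :
  inW [seq (s i : nat).+1 | i <- enum 'I_n].
Proof.
rewrite /inW map_inj_uniq ?enum_uniq; last first.
  by move=> i j [/val_inj/perm_inj].
by apply/allP=> _ /mapP[i _ ->].
Qed.

Definition one_line (n : nat) (s : 'S_n) : W := Word (one_line_inW s).

(* Main.v *)
(** A word [w] that is not increasing is [a * x X * z Y * b], where [a x X] is its first
increasing run, [z Y] is the decreasing part of the special wave and all letters
of [z Y] lie between the last letter of [a] and [x]. Then [delta (sw w)] is the
hook [x * rev (z Y) * X], whose number of inversions is the length of [z Y], and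
removing the wave removes exactly that many descents; so [psi w] is built from
its hook factorization, hook by hook.

The step is reversible: the hook determines the wave, and the wave can be
inserted in [a * b] at exactly one place, namely after the longest increasing
prefix whose letters are all smaller than the least letter of the wave. *)

Require Import Defs.
From mathcomp Require Import all_boot all_fingroup.
From mathcomp Require Import zify.

Set Implicit Arguments.
Unset Strict Implicit.
Unset Printing Implicit Defensive.

(** * Maximal runs *)

Section Runs.
Variables (T : Type) (e : rel T).

Fixpoint run_size (x : T) (s : seq T) : nat :=
  if s is y :: s' then if e x y then (run_size y s').+1 else 0 else 0.

Definition run_stops (x : T) (s : seq T) : bool :=
  if s is y :: _ then ~~ e x y else true.

Lemma run_size_cat x s1 s2 :
  path e x s1 -> run_stops (last x s1) s2 -> run_size x (s1 ++ s2) = size s1.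
Proof.
elim: s1 x => [|y s1 IHs] x /=; first by case: s2 => //= y s _ /negPf ->.
by case/andP=> -> p st; rewrite IHs.
Qed.

Lemma run_decomposition x s : exists s1 s2,
  [/\ s = s1 ++ s2, path e x s1 & run_stops (last x s1) s2].
Proof.
elim: s x => [|y s IHs] x; first by exists [::], [::].
have [s1 [s2 [-> p st]]] := IHs y; case exy : (e x y).
- by exists (y :: s1), s2; rewrite /= exy.
- by exists [::], (y :: s1 ++ s2); rewrite /= exy.
Qed.

End Runs.

(** * The special wave *)

(** Here [m] is the letter just before the wave. Along a decreasing run, requiring [m < v] at every
    step amounts to requiring it at the last one, as [sw_s] does. *)
Definition wave_step (m : nat) : rel nat := fun u v => (v < u) && (m < v).

(* Here [a = w_1 .. w_(r-1)], [x :: X = w_r .. w_t], [z :: Y = w_(t+1) .. w_s]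
   and [b = w_(s+1) .. w_l]. *)
Definition wave_decomposition (a : seq nat) x X z Y b : bool :=
  [&& path ltn 0 (a ++ x :: X), last 0 a < z, z < x,
      path (wave_step (last 0 a)) z Y
    & run_stops (wave_step (last 0 a)) (last z Y) b].

Lemma head_filter_iota_eq (P : pred nat) m n j :
  j \in iota m n -> P j -> (forall i, m <= i < j -> ~~ P i) ->
  head 0 [seq i <- iota m n | P i] = j.
Proof.
move=> jin Pj minj; have [hin Ph /(_ j jin Pj) hj] := head_filter_iotaP jin Pj.
apply/eqP; rewrite eqn_leq hj leqNgt; apply/negP => lt_hj.
by apply: (negP (minj _ _) Ph); move: hin; rewrite mem_iota lt_hj andbT => /andP[].
Qed.

Lemma last_filter_iota_eq (P : pred nat) m n j :
  j \in iota m n -> P j -> (forall i, j < i < m + n -> ~~ P i) ->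
  last 0 [seq i <- iota m n | P i] = j.
Proof.
move=> jin Pj maxj; have [hin Ph /(_ j jin Pj) hj] := last_filter_iotaP jin Pj.
apply/eqP; rewrite eqn_leq hj andbT leqNgt; apply/negP => lt_hj.
by apply: (negP (maxj _ _) Ph); move: hin; rewrite mem_iota lt_hj => /andP[].
Qed.

Lemma path_ltn_last x s y : path ltn x s -> y \in x :: s -> y <= last x s.
Proof.
elim: s x y => [|u s IHs] x y /=; first by rewrite inE => _ /eqP ->.
case/andP=> xu p; rewrite inE => /predU1P[->|]; last exact: IHs.
by apply: leq_trans (ltnW xu) (IHs _ _ p (mem_head _ _)).
Qed.

Section WaveDecomposition.
Variables (a : seq nat) (x : nat) (X : seq nat) (z : nat) (Y b : seq nat).
Let w := a ++ x :: X ++ z :: Y ++ b.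
Hypothesis (dec_w : wave_decomposition a x X z Y b).

Let inc_aX : path ltn 0 (a ++ x :: X). Proof. by case/and5P: dec_w. Qed.
Let lt_az : last 0 a < z. Proof. by case/and5P: dec_w. Qed.
Let lt_zx : z < x. Proof. by case/and5P: dec_w. Qed.
Let path_Y : path (wave_step (last 0 a)) z Y. Proof. by case/and5P: dec_w. Qed.
Let stop_b : run_stops (wave_step (last 0 a)) (last z Y) b.
Proof. by case/and5P: dec_w. Qed.

Let lt_zX : z < last x X.
Proof.
apply: leq_trans lt_zx _; apply: (@path_ltn_last x X); last exact: mem_head.
by move: inc_aX; rewrite cat_path /= => /and3P[].
Qed.

(** The 1-based position of the last letter of [x :: X]; thus [z] stands at position [n.+1]. *)
Let n := (size a + size X).+1.

Let w_split : 0 :: w = (0 :: a ++ x :: X) ++ z :: Y ++ b.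
Proof. by rewrite /w /= -catA. Qed.

Let letter_low i : i <= n -> letter w i = nth 0 (0 :: a ++ x :: X) i.
Proof.
move=> le_in; rewrite /letter w_split nth_cat /= size_cat /=.
by rewrite addnS ltnS le_in.
Qed.

Let letter_high i : letter w (n.+1 + i) = nth 0 (z :: Y ++ b) i.
Proof.
rewrite /letter w_split nth_cat /= size_cat /= addnS -/n.
by rewrite ltnNge leq_addr /= addKn.
Qed.

Let letter_a i : i <= size a -> letter w i <= last 0 a.
Proof.
move=> le_ia; have -> : letter w i = nth 0 (0 :: a) i.
  by rewrite /letter /w -cat_cons nth_cat; move: le_ia; rewrite -ltnS => ->.
apply: path_ltn_last; last by rewrite mem_nth.
by move: inc_aX; rewrite cat_path => /andP[].
Qed.

Let letter_size_a : letter w (size a) = last 0 a.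
Proof. by rewrite /letter /w -cat_cons nth_cat ltnSn (last_nth 0). Qed.

Let letter_x : letter w (size a).+1 = x.
Proof. by rewrite /letter /w -cat_cons nth_cat /= ltnn subnn. Qed.

Let size_w : size w = n + (size Y).+1 + size b.
Proof. by rewrite /w /n; do !rewrite size_cat /=; lia. Qed.

Lemma sw_t_wave : sw_t w = n.
Proof.
apply: head_filter_iota_eq.
- by rewrite mem_iota size_w; lia.
- rewrite -[n.+1]addn0 letter_high letter_low //.
  suff -> : nth 0 (0 :: a ++ x :: X) n = last x X by [].
  have := nth_last 0 (0 :: a ++ x :: X).
  by rewrite /= size_cat /= addnS last_cat.
- move=> i /andP[i_gt0 lt_in]; rewrite -leqNgt ltnW //.
  rewrite (letter_low (ltnW lt_in)) (letter_low lt_in).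
  apply: (pathP 0 inc_aX).
  by rewrite size_cat /= addnS.
Qed.

Lemma sw_r_wave : sw_r w = (size a).+1.
Proof.
rewrite /sw_r sw_t_wave; have -> : letter w n.+1 = z.
  by rewrite -[n.+1]addn0 letter_high.
apply: head_filter_iota_eq.
- by rewrite mem_iota /n; lia.
- by rewrite letter_x.
- by move=> i /andP[_ lt_ia]; rewrite -leqNgt ltnW // (leq_ltn_trans _ lt_az) ?letter_a.
Qed.

(** A longer decreasing run would pass through the head of [b], which [stop_b] then forces to be at
    most [last 0 a]; all later letters of that run are smaller still. *)
Lemma sw_s_wave : sw_s w = n.+1 + size Y.
Proof.
rewrite /sw_s sw_r_wave sw_t_wave /= letter_size_a.
have letY i : i <= size Y -> letter w (n.+1 + i) = nth 0 (z :: Y) i.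
  by move=> le_iY; rewrite letter_high -cat_cons nth_cat /= ltnS le_iY.
have stepY i : i < size Y ->
    wave_step (last 0 a) (letter w (n.+1 + i)) (letter w (n.+1 + i).+1).
  move=> lt_iY; rewrite -addnS (letY _ (ltnW lt_iY)) (letY _ lt_iY).
  exact: (pathP 0 path_Y).
apply: last_filter_iota_eq.
- by rewrite mem_iota size_w; lia.
- apply/andP; split.
    apply/allP=> i; rewrite mem_iota => /andP[le_ni lt_i].
    have -> : i = n.+1 + (i - n.+1) by lia.
    by case/andP: (stepY (i - n.+1) ltac:(lia)).
  (* For empty [Y] the bound on the last letter is [lt_az]; otherwise it comes from the last step of
     [Y]. *)
  case: (posnP (size Y)) => [->|Y_gt0].
    by rewrite addn0 -[n.+1]addn0 letter_high.
  by case/andP: (stepY (size Y).-1 ltac:(lia)) => _; rewrite -addnS prednK.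
- move=> i /andP[lt_i]; rewrite size_w => lt_is.
  apply/negP => /andP[/allP desi lt_ai].
  have b_gt0 : 0 < size b by lia.
  have last_b : letter w (n.+1 + size Y).+1 = head 0 b.
    by rewrite -addnS letter_high /= nth_cat ltnn subnn nth0.
  have last_Y : letter w (n.+1 + size Y) = last z Y.
    by rewrite letY // (last_nth 0).
  have des_b : head 0 b < last z Y.
    by rewrite -last_b -last_Y; apply: desi; rewrite mem_iota; lia.
  have le_b : head 0 b <= last 0 a.
    move: stop_b des_b b_gt0; case: (b) => //= y b' + lt_y _.
    by rewrite /wave_step lt_y /= -leqNgt.
  have : letter w i <= letter w (n.+1 + size Y).+1.
    have -> : i = (n.+1 + size Y).+1 + (i - (n.+1 + size Y).+1) by lia.
    have: forall j, (n.+1 + size Y).+1 + j <= i ->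
        letter w ((n.+1 + size Y).+1 + j) <= letter w (n.+1 + size Y).+1.
      elim=> [|j IHj] le_j; first by rewrite addn0.
      apply: leq_trans (IHj ltac:(lia)); rewrite addnS ltnW //.
      by apply: desi; rewrite mem_iota; lia.
    by apply; lia.
  by rewrite last_b => /(leq_trans lt_ai); rewrite ltnNge le_b.
Qed.

Lemma wave_not_sorted : ~~ sorted ltn w.
Proof.
apply/negP => /cat_sorted2[_] /=; rewrite cat_path /= => /and3P[_ lt_Xz _].
by move: lt_zX; rewrite ltnNge ltnW.
Qed.

Lemma sw_wave : sw w = x :: X ++ z :: Y.
Proof.
rewrite /sw (negPf wave_not_sorted) sw_s_wave sw_r_wave /=.
have -> : w = (a ++ x :: X ++ z :: Y) ++ b by rewrite /w -!catA /= -catA.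
rewrite take_size_cat ?drop_size_cat // /n; do !rewrite size_cat /=; lia.
Qed.

Lemma sw_rest_wave : sw_rest w = a ++ b.
Proof.
rewrite /sw_rest (negPf wave_not_sorted) sw_s_wave sw_r_wave /=.
congr (_ ++ _); first by rewrite take_size_cat.
have -> : w = (a ++ x :: X ++ z :: Y) ++ b by rewrite /w -!catA /= -catA.
rewrite drop_size_cat // /n; do !rewrite size_cat /=; lia.
Qed.

End WaveDecomposition.

Lemma path_last_bound (e : rel nat) m x s :
  (forall u v, e u v -> v < m) -> x < m -> path e x s -> last x s < m.
Proof.
move=> e_m; elim: s x => //= y s IHs x _ /andP[/e_m lt_ym]; exact: IHs.
Qed.

(** Three cuts: [p] is the first increasing run and [z] the letter after it; the longest prefix of
    [p] with letters below [z] is [a]; the maximal [wave_step] run from [z] gives [Y]. Distinctness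
    makes the comparisons strict. *)
Lemma wave_decomposition_exists w : inW w -> ~~ sorted ltn w ->
  exists a x X z Y b,
    w = a ++ x :: X ++ z :: Y ++ b /\ wave_decomposition a x X z Y b.
Proof.
move=> /andP[uniq_w pos_w] nsorted_w.
have [p [[|z q] [def_w inc_p stop_p]]] := run_decomposition ltn 0 w.
  by move: nsorted_w; rewrite def_w cats0 (path_sorted inc_p).
(* Runs start from the fictitious letter 0, so positivity of [z] rules out an empty [p]. *)
have z_gt0 : 0 < z by move/allP: pos_w; apply; rewrite def_w mem_cat mem_head orbT.
have zNp : z \notin p.
  by move: uniq_w; rewrite def_w cat_uniq /= negb_or => /and3P[_ /andP[]].
have lt_zp : z < last 0 p.
  rewrite ltn_neqAle [z <= _]leqNgt (stop_p : ~~ (last 0 p < z)) andbT.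
  have := mem_last 0 p; rewrite inE => /predU1P[->|pin].
    by rewrite -lt0n.
  by apply: contraNneq zNp => ->.
have [a [p2 [def_p small_a stop_a]]] := run_decomposition (fun _ y => y < z) 0 p.
have lt_az : last 0 a < z by apply: path_last_bound small_a.
case: p2 => [|x X] in def_p stop_a.
  by move: lt_zp; rewrite def_p cats0 ltnNge ltnW.
have lt_zx : z < x.
  rewrite ltn_neqAle [z <= _]leqNgt (stop_a : ~~ (x < z)) andbT.
  apply: contraNneq zNp => ->; by rewrite def_p mem_cat mem_head orbT.
have [Y [b [def_q path_Y stop_b]]] :=
  run_decomposition (wave_step (last 0 a)) z q.
exists a, x, X, z, Y, b; split; first by rewrite def_w def_p def_q -catA.
by apply/and5P; split; rewrite // -def_p.
Qed.

(** * Inserting a wave *)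

Definition below (m : nat) : rel nat := fun u v => (u < v) && (v < m).

(* [unhook] inverts [delta] on special waves: since every letter of the
   decreasing part is smaller than the first letter of the wave, the first
   letter of the hook separates the two parts. *)
Definition unhook (h : seq nat) : seq nat :=
  if h is x :: s then x :: [seq y <- s | x < y] ++ rev [seq y <- s | y < x]
  else [::].

(** The second letter of a hook is its least one, hence the least letter of the wave to be
    inserted. *)
Definition insert_wave (u h : seq nat) : seq nat :=
  let k := run_size (below (head 0 (behead h))) 0 u in
  take k u ++ unhook h ++ drop k u.

Lemma path_below m x s : path ltn x s -> last x s < m -> path (below m) x s.
Proof.
elim: s x => //= y s IHs x /andP[lt_xy inc_s] lt_sm.
rewrite /below lt_xy IHs // andbT (leq_ltn_trans _ lt_sm) //.
by apply: path_ltn_last inc_s (mem_head _ _).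
Qed.

Lemma path_gtn_last x s y : path gtn x s -> y \in x :: s -> last x s <= y.
Proof.
elim: s x y => [|u s IHs] x y /=; first by rewrite inE => _ /eqP ->.
case/andP=> lt_ux p; rewrite inE => /predU1P[->|]; last exact: IHs.
by apply: leq_trans (IHs _ _ p (mem_head _ _)) (ltnW lt_ux).
Qed.

Lemma path_wave_step m x s :
  path gtn x s -> m < last x s -> path (wave_step m) x s.
Proof.
elim: s x => //= y s IHs x /andP[lt_yx dec_s] lt_ms.
rewrite /wave_step lt_yx IHs // andbT (leq_trans lt_ms) //.
by apply: path_gtn_last dec_s (mem_head _ _).
Qed.

Lemma wave_step_gtn m x s : path (wave_step m) x s -> path gtn x s.
Proof. by apply: sub_path => u v /andP[]. Qed.

Lemma wave_step_last m x s :
  m < x -> path (wave_step m) x s -> m < last x s.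
Proof. by elim: s x => //= y s IHs x _ /andP[/andP[_ /IHs]]. Qed.

Section WaveShape.
Variables (a : seq nat) (x : nat) (X : seq nat) (z : nat) (Y b : seq nat).
Hypothesis dec : wave_decomposition a x X z Y b.

Let path_X : path ltn x X.
Proof. by case/and5P: dec; rewrite cat_path => /and3P[]. Qed.

Let path_Y : path gtn z Y.
Proof. by case/and5P: dec => _ _ _ /wave_step_gtn. Qed.

Let lt_zx : z < x. Proof. by case/and5P: dec. Qed.

Let all_X : all (ltn x) X.
Proof. exact: order_path_min ltn_trans path_X. Qed.

Lemma all_lt_wave : all (fun y => y < x) (z :: Y).
Proof.
rewrite /= lt_zx; apply/allP=> y yY; apply: ltn_trans lt_zx.
have gtn_trans : transitive gtn by move=> u v t /= uv tu; apply: ltn_trans tu uv.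
by have /allP := order_path_min gtn_trans path_Y; apply.
Qed.

Lemma sorted_wave : sorted ltn (rev (z :: Y) ++ x :: X).
Proof.
have : sorted ltn (rev (z :: Y)) by rewrite rev_sorted.
rewrite rev_cons; case: (rev Y) => [|y s] /=; first by rewrite lt_zx.
by rewrite cat_path => -> /=; rewrite last_rcons lt_zx; exact: path_X.
Qed.

(** The decreasing part lies below [x] and [X] above it. So [x] gets index [size (z :: Y)], the
    number of descents of the wave, and is the letter that [delta] moves to the front. *)
Lemma sort_wave : sort leq (x :: X ++ z :: Y) = rev (z :: Y) ++ x :: X.
Proof.
apply: (sorted_eq leq_trans anti_leq); first exact: sort_sorted leq_total _.
  by apply: (@sub_sorted _ ltn) sorted_wave => u v /ltnW.
by rewrite perm_sort -cat_cons perm_catC perm_cat2r perm_sym perm_rev.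
Qed.

Lemma unhook_wave : unhook (x :: rev (z :: Y) ++ X) = x :: X ++ z :: Y.
Proof.
rewrite /unhook !filter_cat !filter_rev.
have -> : [seq y <- z :: Y | x < y] = [::].
  apply/eqP; rewrite -[_ == _]negbK -has_filter; apply/hasPn => y /(allP all_lt_wave).
  by rewrite -leqNgt => /ltnW.
have -> : [seq y <- X | y < x] = [::].
  apply/eqP; rewrite -[_ == _]negbK -has_filter; apply/hasPn => y /(allP all_X).
  by rewrite -leqNgt => /ltnW.
by rewrite cats0 (all_filterP all_lt_wave) (all_filterP all_X) revK.
Qed.

Lemma insert_wave_rest :
  insert_wave (a ++ b) (x :: rev (z :: Y) ++ X) = a ++ x :: X ++ z :: Y ++ b.
Proof.
case/and5P: dec; rewrite cat_path => /andP[path_a _] lt_az _ step_Y stop_b.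
have lt_aY := wave_step_last lt_az step_Y.
have head_Y : head 0 (rev (z :: Y) ++ X) = last z Y.
  by rewrite lastI rev_rcons.
rewrite /insert_wave [behead _]/= head_Y run_size_cat; first 1 last.
- exact: path_below.
(* The head of [b] would prolong the wave under the very inequalities under which it would prolong
   the prefix [a]; maximality of one is maximality of the other. *)
- by move: stop_b; case: (b) => //= y _; rewrite /wave_step /below andbC.
by rewrite take_size_cat // drop_size_cat // unhook_wave /= -catA.
Qed.

End WaveShape.

(** The tail of the hook is cut where its letters pass [x]: the lower part, reversed, is [z :: Y]
    and the upper part is [X]. The word [u] is cut after its longest increasing prefix below [y],
    the least letter of the hook. *)
Lemma hook_decomposition u h : inW (u ++ h) -> is_hook h ->
  exists a x X z Y b, [/\ u = a ++ b, h = x :: rev (z :: Y) ++ X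
    & wave_decomposition a x X z Y b].
Proof.
case: h => [|x [|y s]] //; rewrite /inW cat_uniq => /andP[/and3P[_ _ uniq_h] pos_uh].
rewrite [is_hook _]/= => /andP[lt_yx inc_s].
have [s1 [X [def_s small_s1 stop_X]]] :=
  run_decomposition (fun _ v => v < x) 0 (y :: s).
case: s1 => [|y' s1] in def_s small_s1 stop_X.
  by move: stop_X; rewrite -[X]/([::] ++ X) -def_s /= lt_yx.
case: def_s small_s1 stop_X => <- def_s small_s1 stop_X.
have [z [Y def_Y]] : exists z Y, rev (z :: Y) = y :: s1.
  case: (lastP s1) => [|s1' z]; first by exists y, [::].
  by exists z, (rev (y :: s1')); rewrite rev_cons revK.
have last_Y : last z Y = y.
  by have := congr1 (head 0 \o id) def_Y; rewrite /= lastI rev_rcons.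
have y_gt0 : 0 < y by move/allP: pos_uh; apply; rewrite mem_cat !inE eqxx !orbT.
have [a [b [def_u path_a stop_b]]] := run_decomposition (below y) 0 u.
exists a, x, X, z, Y, b; split=> //; first by rewrite def_Y def_s.
have lt_ay : last 0 a < y.
  by apply: path_last_bound path_a => // v t /andP[].
have path_Y : path gtn z Y.
  have : sorted gtn (rev (y :: s1)).
    rewrite rev_sorted; move: inc_s; rewrite /= def_s cat_path => /andP[] //.
  by rewrite -def_Y revK.
have lt_az : last 0 a < z.
  apply: leq_trans lt_ay _; rewrite -last_Y.
  exact: path_gtn_last path_Y (mem_head _ _).
have lt_zx : z < x.
  have : z \in y :: s1 by rewrite -def_Y mem_rev mem_head.
  have : all (fun v => v < x) (y :: s1).
    elim: (y :: s1) (0) small_s1 => //= v t IHt v0 /andP[-> p].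
    exact: IHt p.
  by move/allP; apply.
apply/and5P; split=> //.
- rewrite cat_path (sub_path _ path_a) => [|v t /andP[] //] /=.
  rewrite (ltn_trans lt_az) //=.
  move: inc_s; rewrite /= def_s cat_path => /andP[_].
  (* The run stops at a letter that is at least [x]; distinctness excludes equality. *)
  case: (X) def_s stop_X => //= v t def_s; rewrite -leqNgt leq_eqVlt.
  case/predU1P=> [eq_xv|-> /andP[_ ->] //].
  by move: uniq_h; rewrite /= def_s -eq_xv inE mem_cat mem_head !orbT.
- by apply: path_wave_step; rewrite // last_Y.
- by rewrite last_Y; move: stop_b; case: (b) => //= v _; rewrite /wave_step /below andbC.
Qed.

(** * Descents and inversions *)

(* Prepending [0] creates no descent, so [des u = des_from 0 u]. *)
Fixpoint des_from (x : nat) (s : seq nat) : nat :=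
  if s is y :: s' then (y < x) + des_from y s' else 0.

Lemma des_from_cat x s1 s2 :
  des_from x (s1 ++ s2) = des_from x s1 + des_from (last x s1) s2.
Proof. by elim: s1 x => //= y s1 IHs x; rewrite IHs addnA. Qed.

Lemma des_from_inc x s : path ltn x s -> des_from x s = 0.
Proof.
by elim: s x => //= y s IHs x /andP[/ltnW]; rewrite leqNgt => /negPf-> /IHs->.
Qed.

Lemma des_from_dec x s : path gtn x s -> des_from x s = size s.
Proof. by elim: s x => //= y s IHs x /andP[/= -> /IHs->]. Qed.

Lemma desE u : des u = des_from 0 u.
Proof.
case: u => [|x u] /=.
  by apply: eq_card0 => -[].
rewrite /des -sum1_card; under eq_bigl do rewrite inE.
rewrite big_mkcond /= add0n.
elim: u x => [|y u IHu] x /=; first by rewrite big_ord0.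
by rewrite big_ord_recl /= -IHu; case: (y < x).
Qed.

(** An increasing tail has no inversion of its own, so only pairs starting at position 0 count. *)
Lemma inv_cons_sorted x s :
  sorted ltn s -> Defs.inv (x :: s) = count (fun y => y < x) s.
Proof.
move=> inc_s; rewrite /Defs.inv -sum1_card; under eq_bigl do rewrite inE.
rewrite big_mkcond /= -(pair_big predT predT (fun i j : 'I_(size s).+1 =>
  if (i < j) && (nth 0 (x :: s) j < nth 0 (x :: s) i) then 1 else 0)) /=.
rewrite big_ord_recl /= [X in _ + X]big1 ?addn0 => [|i _].
  rewrite big_ord_recl /= add0n -sum1_count (big_nth 0) big_mkord.
  by rewrite [RHS]big_mkcond.
apply: big1 => j _; case: ifP => // /andP[lt_ij].
case: j lt_ij => [[|j] //= lt_j] lt_ij.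
rewrite ltnNge ltnW //.
by apply: (sorted_ltn_nth ltn_trans 0 inc_s); rewrite ?inE ?ltn_ord.
Qed.

Section WaveStatistics.
Variables (a : seq nat) (x : nat) (X : seq nat) (z : nat) (Y b : seq nat).
Hypothesis dec : wave_decomposition a x X z Y b.

Let path_X : path ltn x X.
Proof. by case/and5P: dec; rewrite cat_path => /and3P[]. Qed.

Let path_Y : path gtn z Y.
Proof. by case/and5P: dec => _ _ _ /wave_step_gtn. Qed.

Let lt_zx : z < x. Proof. by case/and5P: dec. Qed.

Let lt_zX : z < last x X.
Proof. by apply: leq_trans lt_zx (path_ltn_last path_X (mem_head _ _)). Qed.

Let des_from_X : des_from x (X ++ z :: Y) = (size Y).+1.
Proof.
by rewrite des_from_cat des_from_inc //= lt_zX des_from_dec // add1n.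
Qed.

Lemma des_wave : des (x :: X ++ z :: Y) = (size Y).+1.
Proof. by rewrite desE /= des_from_X. Qed.

(** The wave brings its own descents and is entered by an ascent. It remains to see that the head of
    [b] is a descent after [last z Y] exactly when it is one after [last 0 a]. *)
Lemma des_wave_rest : inW (a ++ b) ->
  des (a ++ x :: X ++ z :: Y ++ b) = des (a ++ b) + (size Y).+1.
Proof.
(* For empty [a] this letter is 0, which [b] cannot contain; otherwise distinctness applies. *)
move=> abW; have aNb : last 0 a \notin b.
  move: abW; rewrite /inW all_cat cat_uniq => /andP[/and3P[_ abN _] /andP[_ pos_b]].
  have := mem_last 0 a; rewrite inE => /predU1P[->|a_last].
    by apply/negP => /(allP pos_b).
  by apply: contra abN => b_last; apply/hasP; exists (last 0 a).
rewrite !desE !des_from_cat.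
have -> : x :: X ++ z :: Y ++ b = (x :: X ++ z :: Y) ++ b by rewrite /= -catA.
case/and5P: dec; rewrite cat_path => /andP[path_a /andP[lt_ax _]] lt_az _ step_Y stop_b.
rewrite des_from_cat des_from_inc // !add0n /= des_from_X last_cat /=.
rewrite ltnNge (ltnW lt_ax) add0n addnC; congr (_ + _).
have lt_aY := wave_step_last lt_az step_Y.
case: (b) stop_b aNb => //= y b'; rewrite /wave_step inE => stop_y aNb.
(* By maximality of the wave and [aNb], [y] is either below [last 0 a] or not below [last z Y]. *)
by congr (nat_of_bool _ + _); lia.
Qed.

Lemma delta_wave : delta (x :: X ++ z :: Y) = x :: rev (z :: Y) ++ X.
Proof.
rewrite /delta (sort_wave dec) des_wave.
have szY : size (rev (z :: Y)) = (size Y).+1 by rewrite size_rev.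
rewrite nth_cat szY ltnn subnn /= -szY take_size_cat //.
by rewrite -cat_rcons drop_size_cat // size_rcons.
Qed.

Let hook_tail : sorted ltn (rev (z :: Y) ++ X).
Proof.
apply: (subseq_sorted ltn_trans) (sorted_wave dec).
by rewrite cat_subseq ?subseq_cons.
Qed.

Let last_Y_x : last z Y < x.
Proof. by apply: leq_ltn_trans lt_zx; apply: path_gtn_last path_Y (mem_head _ _). Qed.

Lemma delta_wave_hook : is_hook (delta (x :: X ++ z :: Y)).
Proof.
rewrite delta_wave; move: hook_tail; rewrite lastI rev_rcons /= => ->.
by rewrite last_Y_x.
Qed.

Lemma inv_delta_wave : Defs.inv (delta (x :: X ++ z :: Y)) = (size Y).+1.
Proof.
rewrite delta_wave inv_cons_sorted // count_cat count_rev.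
have -> : count (fun y => y < x) X = 0.
  apply/eqP; rewrite -leqn0 leqNgt -has_count; apply/hasPn => y yX.
  by have /allP/(_ y yX)/= := order_path_min ltn_trans path_X; rewrite -leqNgt => /ltnW.
rewrite addn0; apply/eqP; rewrite -[_.+1]/(size (z :: Y)) -all_count.
exact: all_lt_wave dec.
Qed.

End WaveStatistics.

(** With [d = 0] the letter moved to the front is already first. On the empty word the default of
    [nth] would produce [[:: 0]]. *)
Lemma delta_sorted w : w != [::] -> sorted ltn w -> delta w = w.
Proof.
case: w => // x w _ inc_w; rewrite /delta desE /= des_from_inc //.
rewrite sorted_sort /= ?drop0 //; first exact: leq_trans.
by apply: (@sub_path _ ltn) inc_w => u v /ltnW.
Qed.

(** * The bijection *)

Lemma sw_sorted w : sorted ltn w -> sw w = w.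
Proof. by rewrite /sw => ->. Qed.

Lemma sw_rest_sorted w : sorted ltn w -> sw_rest w = [::].
Proof. by rewrite /sw_rest => ->. Qed.

Lemma perm_hook_wave (a : seq nat) x X z Y b :
  perm_eq ((a ++ b) ++ x :: rev (z :: Y) ++ X) (a ++ x :: X ++ z :: Y ++ b).
Proof.
rewrite -catA perm_cat2l perm_catC.
have -> : x :: X ++ z :: Y ++ b = (x :: X ++ z :: Y) ++ b by rewrite /= -catA.
by rewrite perm_cat2r perm_cons perm_catC perm_cat2l perm_rev.
Qed.

(** One step of the recursion only rearranges letters; this yields termination, values in [W] and
    stability of permutations. *)
Lemma perm_sw_rest w :
  inW w -> w != [::] -> perm_eq (sw_rest w ++ delta (sw w)) w.
Proof.
move=> wW w_neq0; case: (boolP (sorted ltn w)) => [inc_w|].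
  by rewrite sw_rest_sorted // sw_sorted // delta_sorted.
case/(wave_decomposition_exists wW)=> a [x [X [z [Y [b [-> dec]]]]]].
by rewrite sw_wave // sw_rest_wave // (delta_wave dec) perm_hook_wave.
Qed.

Lemma size_sw_rest w : inW w -> w != [::] -> size (sw_rest w) < size w.
Proof.
move=> wW w_neq0; rewrite -(perm_size (perm_sw_rest wW w_neq0)) size_cat.
(* [delta] always returns a nonempty word. *)
by rewrite -[X in X < _]addn0 ltn_add2l.
Qed.

Lemma inW_perm u v : perm_eq u v -> inW u = inW v.
Proof. by move=> uv; rewrite /inW (perm_uniq uv) (perm_all _ uv). Qed.

(** All increasing words serve as base cases, since [psi] fixes them; every other word has a genuine
    wave to remove. *)
Lemma restW_ind (P : W -> Prop) :
  (forall w : W, sorted ltn w -> P w) ->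
  (forall w : W, ~~ sorted ltn w -> P (restW w) -> P w) ->
  forall w, P w.
Proof.
move=> Psorted Pwave w; have [k] := ubnP (size w).
elim: k w => // k IHk w lt_wk; case: (boolP (sorted ltn w)) => [/Psorted //|ninc].
apply: Pwave => //; apply: IHk; apply: leq_trans (lt_wk : size w <= k).
by apply: size_sw_rest; [case: (w) | apply: contraNneq ninc => ->].
Qed.

(** The recursion is not structural, so [k] bounds its depth; the length of [w] suffices. *)
Fixpoint psi_seq (k : nat) (w : seq nat) : seq nat :=
  if k is k'.+1 then
    if w is [::] then [::] else psi_seq k' (sw_rest w) ++ delta (sw w)
  else [::].

Lemma psi_seqS k w : w != [::] ->
  psi_seq k.+1 w = psi_seq k (sw_rest w) ++ delta (sw w).
Proof. by case: w. Qed.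

(** Needed because a recursive call inherits the bound [(size w).-1], while [psiW] uses the length
    of the remaining word. *)
Lemma psi_seq_fuel k l (w : W) :
  size w <= k -> size w <= l -> psi_seq k w = psi_seq l w.
Proof.
elim: k l w => [|k IHk] [|l] w //.
- by rewrite leqn0 size_eq0 => /eqP->.
- by move=> _; rewrite leqn0 size_eq0 => /eqP->.
case: (eqVneq (letters w) [::]) => [-> //|w_neq0] wk wl.
have lt_rest : size (sw_rest w) < size w by apply: size_sw_rest; case: (w) w_neq0.
by rewrite !psi_seqS // (IHk l (restW w)) //=; lia.
Qed.

Lemma perm_psi_seq k (w : W) : size w <= k -> perm_eq (psi_seq k w) w.
Proof.
elim: k w => [|k IHk] w; first by rewrite leqn0 size_eq0 => /eqP->.
case: (eqVneq (letters w) [::]) => [-> //|w_neq0] wk.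
have wW : inW w by case: (w).
rewrite psi_seqS // -(permPr (perm_sw_rest wW w_neq0)) perm_cat2r.
by apply: (IHk (restW w)); have := size_sw_rest wW w_neq0; rewrite /=; lia.
Qed.

Lemma psi_seq_inW (w : W) : inW (psi_seq (size w) w).
Proof. by rewrite (inW_perm (perm_psi_seq (leqnn _))); case: w. Qed.

Definition psiW (w : W) : W := Word (psi_seq_inW w).

Lemma psiW_recursion : psi_recursion psiW.
Proof.
split=> [|w w_neq0]; first exact: val_inj.
have {}w_neq0 : letters w != [::] by apply/eqP => w0; apply: w_neq0; apply: val_inj.
have wW : inW w by case: (w).
have lt_rest := size_sw_rest wW w_neq0.
rewrite /=; case def_n: (size w) lt_rest => [|k] // lt_rest.
by rewrite psi_seqS // (@psi_seq_fuel k (size (sw_rest w)) (restW w)).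
Qed.

(** * Properties of every solution of the recursion *)

Section PsiRecursion.
Variables (psi : W -> W) (psi_rec : psi_recursion psi).

Lemma psi_sorted (w : W) : sorted ltn w -> psi w = w.
Proof.
move=> inc_w; have [psi0 psiS] := psi_rec.
case: (eqVneq w emptyW) => [-> //|w_neq0].
apply: val_inj; rewrite /= psiS; last exact/eqP.
have -> : restW w = emptyW by apply: val_inj; rewrite /= sw_rest_sorted.
by rewrite psi0 /= sw_sorted // delta_sorted.
Qed.

Lemma psi_wave (w : W) : ~~ sorted ltn w ->
  letters (psi w) = letters (psi (restW w)) ++ delta (sw w).
Proof. by move=> ninc; apply: psi_rec.2 => w0; rewrite w0 in ninc. Qed.

Lemma perm_psi (w : W) : perm_eq (psi w) w.
Proof.
elim/restW_ind: w => [w /psi_sorted-> //|w ninc IHw]; rewrite psi_wave //.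
apply: (@perm_trans _ (sw_rest w ++ delta (sw w))); first by rewrite perm_cat2r.
by apply: perm_sw_rest; [case: (w) | apply: contraNneq ninc => ->].
Qed.

Lemma hook_factorization_sorted (w : W) :
  sorted ltn w -> is_hook_factorization (psi w) (letters w, [::]).
Proof.
by move=> inc; rewrite psi_sorted // /is_hook_factorization /= cats0 eqxx inc.
Qed.

(** The first wave removed becomes the last hook; the increasing part and the earlier hooks come
    from the remaining word. *)
Lemma hook_factorization_wave (w : W) g al : ~~ sorted ltn w ->
  is_hook_factorization (psi (restW w)) (g, al) ->
  is_hook_factorization (psi w) (g, rcons al (delta (sw w))).
Proof.
move=> ninc /and3P[/= /eqP def_rest inc_g al_hook]; apply/and3P; split=> //=.
  by rewrite psi_wave // def_rest flatten_rcons catA.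
rewrite all_rcons al_hook andbT.
have [|a [x [X [z [Y [b [-> dec]]]]]]] := wave_decomposition_exists _ ninc.
  by case: (w).
by rewrite sw_wave // (delta_wave_hook dec).
Qed.

Lemma psi_hook_factorization (w : W) : exists g al,
  is_hook_factorization (psi w) (g, al) /\ des w = \sum_(h <- al) Defs.inv h.
Proof.
elim/restW_ind: w => [w inc|w ninc [g [al [fact_rest des_rest]]]].
  exists (letters w), [::]; rewrite hook_factorization_sorted // big_nil desE.
  by split=> //; case: (letters w) inc => //= x s inc; rewrite des_from_inc.
exists g, (rcons al (delta (sw w))); split; first exact: hook_factorization_wave.
rewrite -cats1 big_cat big_seq1 -des_rest [letters (restW w)]/=.
have := sw_rest_inW w.
have [|a [x [X [z [Y [b [-> dec]]]]]]] := wave_decomposition_exists _ ninc.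
  by case: (w).
rewrite sw_wave // sw_rest_wave // (inv_delta_wave dec) => abW.
exact: des_wave_rest.
Qed.

(** Uniqueness identifies the factorization chosen in [lec] with the one built from the waves. *)
Lemma des_lec_psi (w : W) : des w = lec (psi w).
Proof.
have [g [al [fact_w ->]]] := psi_hook_factorization w; rewrite /lec.
have fact_w' := xchooseP (hook_factorization_exists (psi w)).
by rewrite /hook_factorization (hook_factorization_unique fact_w' fact_w).
Qed.

(** * Inverting the recursion *)

Lemma insert_wave_sw (w : W) : ~~ sorted ltn w ->
  insert_wave (sw_rest w) (delta (sw w)) = w.
Proof.
case/wave_decomposition_exists=> [|a [x [X [z [Y [b [-> dec]]]]]]].
  by case: (w).
by rewrite sw_wave // sw_rest_wave // (delta_wave dec) (insert_wave_rest dec).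
Qed.

(** The factorization of [psi w] has no hook exactly when [w] is increasing. Otherwise its last hook
    is [delta (sw w)] and the part before it is [psi (restW w)]; by induction both are determined,
    and [insert_wave] recovers [w]. *)
Lemma psi_inj : injective psi.
Proof.
have sorted_neq_wave (w1 w2 : W) :
    sorted ltn w1 -> ~~ sorted ltn w2 -> psi w1 <> psi w2.
  move=> inc1 ninc2 eq_psi; have := hook_factorization_sorted inc1.
  have [g [al [/(hook_factorization_wave ninc2) fact2 _]]] :=
    psi_hook_factorization (restW w2).
  rewrite eq_psi => /(hook_factorization_unique fact2)[_].
  by case: (al).
move=> w1; elim/restW_ind: w1 => [w1 inc1 w2 eq_psi|w1 ninc1 IHw w2 eq_psi].
  case: (boolP (sorted ltn w2)) => [inc2|ninc2].
    by rewrite -(psi_sorted inc1) -(psi_sorted inc2).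
  by case: (sorted_neq_wave _ _ inc1 ninc2).
case: (boolP (sorted ltn w2)) => [inc2|ninc2].
  by case: (sorted_neq_wave _ _ inc2 ninc1).
have [g1 [al1 [fact1 _]]] := psi_hook_factorization (restW w1).
have [g2 [al2 [fact2 _]]] := psi_hook_factorization (restW w2).
have := hook_factorization_wave ninc2 fact2; rewrite -eq_psi.
case/(hook_factorization_unique (hook_factorization_wave ninc1 fact1)).
move=> eq_g /rcons_inj eq_rcons.
have eq_al : al1 = al2 := congr1 fst eq_rcons.
have eq_delta : delta (sw w1) = delta (sw w2) := congr1 snd eq_rcons.
have /IHw/(congr1 letters)/= eq_rest : psi (restW w1) = psi (restW w2).
  apply: val_inj => /=; case/and3P: fact1 => /eqP -> _ _.
  case/and3P: fact2 => /eqP -> _ _.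
  by rewrite /= eq_g eq_al.
apply: val_inj; rewrite /= -(insert_wave_sw ninc1) -(insert_wave_sw ninc2).
by rewrite eq_rest eq_delta.
Qed.

(** Induction on the hooks: strip the last hook [h], take a preimage [u] of what remains, and insert
    into [u] the wave encoded by [h]. *)
Lemma psi_surj (v : W) : exists w, psi w = v.
Proof.
have [[g al]] := hook_factorization_exists v.
elim/last_ind: al v => [|al h IHal] v /and3P[/= /eqP def_v inc_g].
  by move=> _; exists v; apply: psi_sorted; rewrite def_v cats0.
rewrite all_rcons => /andP[hook_h hook_al].
have uW : inW (g ++ flatten al).
  have : inW v by case: (v).
  rewrite def_v flatten_rcons catA /inW cat_uniq all_cat.
  by case/andP=> /and3P[-> _ _] /andP[-> _].
have [|u def_u] := IHal (Word uW); first by rewrite /is_hook_factorization /= eqxx inc_g.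
have perm_u : perm_eq u (g ++ flatten al).
  by rewrite perm_sym -[g ++ _]/(letters (Word uW)) -def_u perm_psi.
have perm_uh : perm_eq (u ++ h) v by rewrite def_v flatten_rcons catA perm_cat2r.
(* [u] rearranges the part of [v] before [h], so [u] and [h] share no letter. *)
have uhW : inW (u ++ h) by rewrite (inW_perm perm_uh); case: (v).
have [a [x [X [z [Y [b [eq_u eq_h dec]]]]]]] := hook_decomposition uhW hook_h.
have wW : inW (a ++ x :: X ++ z :: Y ++ b).
  by rewrite -(inW_perm (perm_hook_wave _ _ _ _ _ _)) -eq_u -eq_h.
exists (Word wW); apply: val_inj; rewrite /= psi_wave; last exact: wave_not_sorted.
have -> : restW (Word wW) = u by apply: val_inj; rewrite /= sw_rest_wave.
by rewrite def_u /= sw_wave // (delta_wave dec) def_v flatten_rcons -eq_h catA.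
Qed.

Lemma psi_bij : bijective psi.
Proof.
(* The boolean equality lets [xchoose] pick a preimage in the countable type [W]. *)
have surj v : exists w, psi w == v by have [w <-] := psi_surj v; exists w.
exists (fun v => xchoose (surj v)) => [w|v]; last exact/eqP/(xchooseP (surj v)).
by apply: psi_inj; apply/eqP/(xchooseP (surj (psi w))).
Qed.

End PsiRecursion.

Lemma psi_recursion_unique (psi psi' : W -> W) :
  psi_recursion psi -> psi_recursion psi' -> psi' =1 psi.
Proof.
move=> rec rec' w; elim/restW_ind: w => [w inc|w ninc IHw].
  by rewrite !psi_sorted.
by apply: val_inj; rewrite /= (psi_wave rec ninc) (psi_wave rec' ninc) IHw.
Qed.

(** * Permutations in one-line notation *)

Lemma one_line_inj n : injective (@one_line n).
Proof.
move=> s1 s2 /(congr1 letters)/= eq_s; apply/permP => i; apply: val_inj.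
have /eq_in_map/(_ i) := eq_s.
by rewrite mem_enum => /(_ isT)[].
Qed.

Lemma perm_one_line n (s : 'S_n) : perm_eq (one_line s) (iota 1 n).
Proof.
have sW := one_line_inW s; apply: uniq_perm; first by case/andP: sW.
  exact: iota_uniq.
have sub_s : {subset letters (one_line s) <= iota 1 n}.
  by move=> _ /mapP[i _ ->]; rewrite mem_iota /= add1n ltnS ltn_ord.
(* A word of [n] distinct letters from [iota 1 n] contains all of them. *)
have [] // := uniq_min_size _ sub_s; first by case/andP: sW.
by rewrite size_iota size_map size_enum_ord.
Qed.

Lemma perm_iota_one_line n (w : W) :
  perm_eq w (iota 1 n) -> exists s : 'S_n, w = one_line s.
Proof.
move=> perm_w; have wW : uniq w by rewrite (perm_uniq perm_w) iota_uniq.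
have size_w : size w = n by rewrite (perm_size perm_w) size_iota.
have bound (i : 'I_n) : 0 < nth 0 w i <= n.
  have : nth 0 w i \in iota 1 n by rewrite -(perm_mem perm_w) mem_nth ?size_w.
  by rewrite mem_iota add1n ltnS.
have lt_n (i : 'I_n) : (nth 0 w i).-1 < n.
  by case/andP: (bound i) => w_gt0; rewrite -{1}(prednK w_gt0).
have inj : injective (fun i => Ordinal (lt_n i)).
  move=> i j /(congr1 val)/= eq_ij; apply/val_inj/eqP.
  rewrite /= -(nth_uniq 0 _ _ wW) ?size_w //.
  (* Positivity makes the predecessor injective on the letters. *)
  have /andP[wi_gt0 _] := bound i; have /andP[wj_gt0 _] := bound j.
  by rewrite -(prednK wi_gt0) -(prednK wj_gt0) eq_ij.
exists (perm inj); apply: val_inj; apply: (@eq_from_nth _ 0) => /=.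
  by rewrite size_map size_enum_ord.
rewrite size_w => i lt_in; rewrite (nth_map (Ordinal lt_in)) ?size_enum_ord //.
rewrite permE /= nth_enum_ord // prednK //.
by case/andP: (bound (Ordinal lt_in)).
Qed.

Theorem theorem6p11 :
  exists psi : W -> W,
    [/\ psi_recursion psi,
        forall psi' : W -> W, psi_recursion psi' -> psi' =1 psi,
        bijective psi,
        forall w : W, des w = lec (psi w)
      & forall n : nat, exists2 phi : 'S_n -> 'S_n,
          bijective phi
        & forall s : 'S_n, psi (one_line s) = one_line (phi s)].
Proof.
have psi_rec := psiW_recursion.
exists psiW; split=> //.
- by move=> psi'; apply: psi_recursion_unique.
- exact: psi_bij.
- exact: des_lec_psi.
move=> n; have /fin_all_exists[phi phiP] (s : 'S_n) :
    exists s' : 'S_n, psiW (one_line s) = one_line s'.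
  apply: perm_iota_one_line; apply: perm_trans (perm_one_line s).
  exact: perm_psi.
(* On the finite set ['S_n] injectivity suffices, and [phi] inherits it from [psiW]. *)
exists phi => //; apply: injF_bij => s1 s2 eq_phi.
by apply/one_line_inj/(psi_inj psi_rec); rewrite !phiP eq_phi.
Qed.
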